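(* Let $N$ be an even positive integer and let $(X,\|\cdot\|)$ be a real Banach space such that $\|\cdot\|$ is a polynomial norm of degree $N$. Then $\|\cdot\|$ has modulus of uniform convexity of power type $N$; that is, there is a constant $C>0$ such that $\delta_X(\varepsilon)\ge C\varepsilon^N$ for all $\varepsilon\in(0,2]$.
   Context: Polynomial norm of degree $N$: there is an $N$-homogeneous polynomial $P$ on $X$ (i.e. $P(x)=A(x,\dots,x)$ for some symmetric, $N$-linear, continuous $A:X\times\cdots\times X\to\mathbb{R}$) such that $P(x)=\|x\|^N$ for every $x\in X$. Modulus of uniform convexity: for $\varepsilon\in(0,2]$, $\delta_X(\varepsilon)=\inf\{1-\frac{\|x+y\|}{2}: x,y\in X,\ \|x\|=\|y\|=1,\ \|x-y\|=\varepsilon\}$ (with the usual convention $\inf\emptyset=+\infty$). *)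

(* Defs.v *)
From HB Require Import structures.
From mathcomp Require Import all_boot all_order all_algebra all_fingroup.
From mathcomp Require Import all_classical all_reals all_analysis.

Set Implicit Arguments.
Unset Strict Implicit.
Unset Printing Implicit Defensive.

Import Order.TTheory GRing.Theory Num.Theory.
Import numFieldNormedType.Exports.

Local Open Scope classical_set_scope.
Local Open Scope ring_scope.

Section PolynomialNorm.
Context {R : realType} {X : normedModType R}.

(* [dfwith x i u] is the family x whose i-th entry has been replaced by u, and
   [scalar] means linear with values in the base field. *)
Definition multilinear_form (N : nat) (A : {ptws 'I_N -> X} -> R) :=
  forall (i : 'I_N) (x : 'I_N -> X),
    scalar (fun u : X => A (dfwith x i u)).

Definition symmetric_multiform (N : nat) (A : {ptws 'I_N -> X} -> R) :=
  forall (s : 'S_N) (x : 'I_N -> X), A (fun i => x (s i)) = A x.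

(* Continuity is joint, for the product topology on X x ... x X, which is the
   topology carried by [{ptws 'I_N -> X}]. *)
Definition homogeneous_polynomial (N : nat) (P : X -> R) :=
  exists A : {ptws 'I_N -> X} -> R,
    [/\ symmetric_multiform A, multilinear_form A, continuous A
      & forall x : X, P x = A (fun=> x)].

End PolynomialNorm.

Section Convexity.
Context {R : realType} (X : normedModType R).

Definition polynomial_norm (N : nat) :=
  exists2 P : X -> R, homogeneous_polynomial N P
    & forall x : X, P x = `|x| ^+ N.

(* Extended-real valued, so that the infimum of the empty set is +oo. *)
Definition modulus_convexity (eps : R) : \bar R :=
  ereal_inf [set (1 - `|z.1 + z.2| / 2)%:E | z in
    [set z : X * X | [/\ `|z.1| = 1, `|z.2| = 1 & `|z.1 - z.2| = eps]]].

Definition convexity_power_type (N : nat) :=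
  exists2 C : R, 0 < C &
    forall eps : R, 0 < eps <= 2 ->
      ((C * eps ^+ N)%:E <= modulus_convexity eps)%E.

End Convexity.

(* Main.v *)
Require Import Defs.
From mathcomp Require Import all_boot all_order all_algebra all_fingroup.
From mathcomp Require Import all_classical all_reals all_analysis.
From mathcomp Require Import lra ring.

Set Implicit Arguments.
Unset Strict Implicit.
Unset Printing Implicit Defensive.

Import Order.TTheory GRing.Theory Num.Theory.
Import numFieldNormedType.Exports.

Local Open Scope ring_scope.

(** Put the two unit vectors as m + h and m - h, so that m is their midpoint
    and |h| = eps / 2.  For a polynomial norm of degree N, the function
      r(t) = |m + t h|^N + |m - t h|^N - 2 |m|^N
    is a polynomial in t of degree at most N, because an N-linear form restricts
    to such a polynomial on every line ([multilinear_form_line]); its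
    coefficient of degree N is |h|^N + |- h|^N = 2 |h|^N, the values of the form
    at the two directions.  On [0, 1] it is small: convexity of |u|^N in u makes
    it nonnegative, and since m + t h and m - t h lie on the segment joining the
    two unit vectors, it is at most 2 (1 - |m|^N).

    A polynomial of degree at most N has its coefficient of degree N bounded by
    a constant times its largest absolute value at N + 1 fixed nodes
    ([coef_interpolation_bound]).  With nodes in [0, 1] this gives
      |h|^N <= K (1 - |m|^N)
    with K depending on N only ([polynomial_norm_midpoint_defect]), and
    1 - |m|^N <= N (1 - |m|) turns the right-hand side into a multiple of
    1 - |m|, the quantity minimised by the modulus of convexity. *)

(** The coefficient of degree n is the divided difference of p at the n + 1
    nodes.  The induction follows the recursion for divided differences: writing
    p - p(x0) = q (X - x0), the top coefficient of q is that of p, and q is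
    bounded at each remaining node x by 2 M / |x - x0|. *)
Lemma coef_interpolation_bound (F : numFieldType) (xs : seq F) : uniq xs ->
  exists2 K : F, 0 < K &
    forall (p : {poly F}) (M : F), (size p <= size xs)%N -> 0 <= M ->
      (forall x, x \in xs -> `|p.[x]| <= M) -> `|p`_(size xs).-1| <= K * M.
Proof.
case: xs => [|x0 xs] /=.
  move=> _; exists 1 => // p M; rewrite leqn0 size_poly_eq0 => /eqP-> M0 _.
  by rewrite coef0 normr0 mul1r.
elim: xs x0 => [|x1 xs IH] x0 /=.
  move=> _; exists 1 => // p M sp _ /(_ x0); rewrite mem_head mul1r => /(_ isT).
  by rewrite {1}(size1_polyC sp) hornerC.
move=> /andP[x0xs /IH [K K0 HK]].
have dist x : x \in x1 :: xs -> `|x - x0| != 0.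
  by move=> xin; rewrite normr_eq0 subr_eq0; apply: contraNneq x0xs => <-.
(* S only has to dominate every |x - x0|^-1. *)
pose S := \sum_(x <- x1 :: xs) `|x - x0|^-1.
have S_ge x : x \in x1 :: xs -> `|x - x0|^-1 <= S.
  move=> xin; rewrite /S (big_rem x xin) /= lerDl.
  by apply: sumr_ge0 => y _; rewrite invr_ge0.
have S0 : 0 < S.
  apply: lt_le_trans (S_ge x1 (mem_head _ _)).
  by rewrite invr_gt0 lt0r dist ?mem_head/=.
exists (K * (2 * S)); first by rewrite !mulr_gt0.
move=> p M sp M0 pM.
have /factor_theorem[q pq] : root (p - p.[x0]%:P) x0.
  by rewrite rootE !hornerE subrr.
have sq : (size q <= (size xs).+1)%N.
  have [->|q0] := eqVneq q 0; first by rewrite size_poly0.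
  have : (size (p - p.[x0]%:P)%R <= (size xs).+2)%N.
    by rewrite (leq_trans (size_polyD _ _))// geq_max sp size_polyN
      (leq_trans (size_polyC_leq1 _)).
  by rewrite pq size_Mmonic ?monicXsubC// size_XsubC addn2.
have -> : p`_(size xs).+1 = q`_(size xs).
  have /(congr1 (fun r : {poly F} => r`_(size xs).+1)) := pq.
  rewrite coefB coefC subr0 mulrBr coefB coefMX/= coefMC => ->.
  by rewrite (nth_default _ sq) mul0r subr0.
rewrite -mulrA; apply: HK => [||x xin].
- exact: sq.
- by rewrite !mulr_ge0// ltW.
have qx : q.[x] = (p.[x] - p.[x0]) / (x - x0).
  have := congr1 (fun r => r.[x]) pq; rewrite !hornerE => ->.
  by rewrite mulfK// -normr_eq0 dist.
rewrite qx normf_div mulrAC ler_pM ?invr_ge0 ?S_ge//.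
rewrite (le_trans (ler_normB _ _))// mulr_natl mulr2n lerD// pM ?mem_head//.
by rewrite inE xin orbT.
Qed.

(** The arguments are moved onto the line one at a time.  Moving one more
    argument splits the form, by linearity in it, as p + q X, where p and q
    belong to the values m and h of that argument; so the degree grows by one
    and the top coefficient comes from q, hence sees only h. *)
Lemma multilinear_form_line (R : realType) (X : normedModType R) (N : nat)
    (A : {ptws 'I_N -> X} -> R) (m h : X) : multilinear_form A ->
  exists p : {poly R}, [/\ (size p <= N.+1)%N, p`_N = A (fun=> h)
    & forall t : R, p.[t] = A (fun=> m + t *: h)].
Proof.
move=> linA.
(* [x] supplies the arguments of index at least k, which stay fixed; it must be
   arbitrary, since the step uses the induction hypothesis for two families. *)
suff H k (x : 'I_N -> X) : (k <= N)%N -> exists p : {poly R},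
    [/\ (size p <= k.+1)%N, p`_k = A (fun i => if (i < k)%N then h else x i)
      & forall t : R,
        p.[t] = A (fun i => if (i < k)%N then m + t *: h else x i)].
  have [p [sp pN pt]] := H N (fun=> h) (leqnn N).
  exists p; split=> // [|t].
    by rewrite pN; congr A; apply/funext => i; rewrite ltn_ord.
  by rewrite pt; congr A; apply/funext => i; rewrite ltn_ord.
elim: k x => [|k IH] x.
  move=> _; exists (A x)%:P; split=> [||t].
  - exact: size_polyC_leq1.
  - by rewrite coefC.
  - by rewrite hornerC.
move=> kN; pose j := Ordinal kN.
have split_k (u : X) : (fun i : 'I_N => if (i < k.+1)%N then u else x i) =
    dfwith (fun i : 'I_N => if (i < k)%N then u else x i) j u.
  apply/funext => i; have [->|ij] := eqVneq i j.
    by rewrite dfwithin /= ltnSn.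
  rewrite dfwithout 1?eq_sym// ltnS leq_eqVlt.
  by rewrite (_ : (i == k :> nat) = false)//; apply/negbTE.
have dfwith_k (u v : X) :
    (fun i : 'I_N => if (i < k)%N then u else dfwith x j v i) =
    dfwith (fun i : 'I_N => if (i < k)%N then u else x i) j v.
  apply/funext => i; have [->|ij] := eqVneq i j.
    by rewrite !dfwithin /= ltnn.
  by rewrite !dfwithout 1?eq_sym.
have [p [sp pk pt]] := IH (dfwith x j m) (ltnW kN).
have [q [sq qk qt]] := IH (dfwith x j h) (ltnW kN).
exists (p + q * 'X); split=> [||t].
- rewrite (leq_trans (size_polyD _ _))// geq_max (leq_trans sp)//=.
  have [->|q0] := eqVneq q 0; first by rewrite mul0r size_poly0.
  by rewrite size_mulX.
- rewrite coefD coefMX /= (nth_default _ sp) add0r qk.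
  by rewrite split_k ?dfwith_k.
rewrite hornerD hornerMX pt qt split_k// !dfwith_k addrC mulrC.
by rewrite [m + _]addrC linA.
Qed.

(** Induction on n: the step is Chebyshev's sum inequality, a and b being
    ordered in the same way as a^n and b^n. *)
Lemma midpoint_expr_le (F : realFieldType) (n : nat) (a b : F) :
  0 <= a -> 0 <= b -> 2 * ((a + b) / 2) ^+ n <= a ^+ n + b ^+ n.
Proof.
move=> a0 b0; elim: n => [|n IH]; first by rewrite !expr0 mulr1.
have cross : 0 <= (a - b) * (a ^+ n - b ^+ n).
  have [ab|/ltW ba] := leP b a.
    by rewrite mulr_ge0// subr_ge0// lerXn2r.
  by rewrite mulr_le0// subr_le0// lerXn2r.
have : 2 * ((a + b) / 2) ^+ n.+1 <= (a ^+ n + b ^+ n) * ((a + b) / 2).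
  by rewrite exprSr mulrA ler_wpM2r// divr_ge0// addr_ge0.
move=> /le_trans; apply; rewrite !exprSr; lra.
Qed.

Lemma subr1_expr_le (F : realFieldType) (n : nat) (s : F) :
  0 <= s <= 1 -> 1 - s ^+ n <= n%:R * (1 - s).
Proof.
move=> /andP[s0 s1]; elim: n => [|n IH]; first by rewrite expr0 subrr mul0r.
have : s * (1 - s ^+ n) <= 1 - s ^+ n.
  by rewrite ler_piMl// subr_ge0 exprn_ile1.
by rewrite exprS -natr1; lra.
Qed.

(** The interpolation bound is applied to r(t) = |m + t h|^N + |m - t h|^N
    - 2 |m|^N on [0, 1].  Symmetrising in h is what makes r nonnegative: along
    the line itself the norm may well drop below |m|. *)
Lemma polynomial_norm_midpoint_defect (R : realType) (X : normedModType R)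
    (N : nat) : (0 < N)%N -> polynomial_norm X N ->
  exists2 K : R, 0 < K & forall m h : X,
    `|m + h| <= 1 -> `|m - h| <= 1 -> `|h| ^+ N <= K * (1 - `|m| ^+ N).
Proof.
move=> N_gt0 [P [A [_ linA _ PA]] PE].
(* Any N + 1 distinct points of [0, 1] would do. *)
pose nodes : seq R := [seq i.+1%:R^-1 | i <- iota 0 N.+1].
have nodes_uniq : uniq nodes.
  rewrite map_inj_uniq ?iota_uniq// => i j /invr_inj/eqP.
  by rewrite eqr_nat => /eqP[].
have nodes_size : size nodes = N.+1 by rewrite size_map size_iota.
have nodes01 t : t \in nodes -> 0 <= t <= 1.
  by move=> /mapP[i _ ->]; rewrite invr_ge0 ler0n invf_le1 ?ltr0n// ler1n.
have [K K0 HK] := coef_interpolation_bound nodes_uniq.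
rewrite nodes_size /= in HK.
exists K => // m h mDh mBh.
have on_segment (t : R) : `|t| <= 1 -> `|m + t *: h| <= 1.
  rewrite ler_norml => /andP[t0 t1].
  have -> : m + t *: h = ((1 + t) / 2) *: (m + h) + ((1 - t) / 2) *: (m - h).
    rewrite !scalerDr !scalerN addrACA -scalerDl -scalerBl.
    by rewrite -[in LHS](scale1r m); congr (_ *: _ + _ *: _); lra.
  have c0 : 0 <= (1 + t) / 2 by lra.
  have d0 : 0 <= (1 - t) / 2 by lra.
  apply: le_trans (ler_normD _ _) _.
  rewrite (normrZ _ (m + h)) (normrZ _ (m - h)) (ger0_norm c0) (ger0_norm d0).
  have := ler_wpM2l c0 mDh; have := ler_wpM2l d0 mBh; lra.
have m1 : `|m| <= 1.
  by have := on_segment 0; rewrite normr0 scale0r addr0; apply.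
have [p [sp pN pt]] := multilinear_form_line m h linA.
have [q [sq qN qt]] := multilinear_form_line m (- h) linA.
pose r := p + q - (2 * `|m| ^+ N)%:P.
have r_size : (size r <= N.+1)%N.
  rewrite (leq_trans (size_polyD _ _))// geq_max size_polyN.
  rewrite (leq_trans (size_polyC_leq1 _))// andbT.
  by rewrite (leq_trans (size_polyD _ _))// geq_max sp.
have r_lead : r`_N = 2 * `|h| ^+ N.
  (* The subtracted constant leaves the coefficient of degree N > 0 alone. *)
  rewrite /r coefB coefD coefC -[N == 0%N]negbK -lt0n N_gt0 subr0.
  by rewrite pN qN -!PA !PE normrN -mulr2n mulr_natl.
have r_val t : r.[t] =
    `|m + t *: h| ^+ N + `|m + t *: - h| ^+ N - 2 * `|m| ^+ N.
  by rewrite !hornerE pt qt -!PA !PE.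
have : `|r`_N| <= K * (2 * (1 - `|m| ^+ N)).
  apply: HK => // [|t /nodes01/andP[t0 t1]].
    by rewrite mulr_ge0// subr_ge0 exprn_ile1.
  have a1 : `|m + t *: h| <= 1 by rewrite on_segment// ger0_norm.
  have b1 : `|m + t *: - h| <= 1.
    by rewrite scalerN -scaleNr on_segment// normrN ger0_norm.
  rewrite r_val ger0_norm.
    have := exprn_ile1 N (normr_ge0 _) a1.
    by have := exprn_ile1 N (normr_ge0 _) b1; lra.
  rewrite subr_ge0.
  apply: le_trans (midpoint_expr_le N (normr_ge0 _) (normr_ge0 _)).
  rewrite ler_wpM2l// lerXn2r ?nnegrE ?divr_ge0 ?addr_ge0// ler_pdivlMr//.
  apply: le_trans (ler_normD _ _).
  by rewrite scalerN addrACA subrr addr0 -mulr2n normrMn mulr_natr.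
rewrite r_lead ger0_norm; last by rewrite mulr_ge0// exprn_ge0.
by rewrite mulrCA ler_pM2l.
Qed.

Theorem theorem2 (R : realType) (X : completeNormedModType R) (N : nat)
    (N_gt0 : (0 < N)%N) (N_even : ~~ odd N) (normP : polynomial_norm X N) :
  convexity_power_type X N.
Proof.
have [K K0 HK] := polynomial_norm_midpoint_defect N_gt0 normP.
have D0 : 0 < K * N%:R * 2 ^+ N.
  by rewrite !mulr_gt0// ?exprn_gt0 ?ltr0n.
(* K N comes from the bound on |h|^N, and 2^N from eps = 2 |h|. *)
exists (K * N%:R * 2 ^+ N)^-1; first by rewrite invr_gt0.
move=> eps _; apply: le_ereal_inf_tmp => _ [[x y] /= [x1 y1 xy] <-].
rewrite lee_fin ler_pdivrMl//.
pose m := 2^-1 *: (x + y); pose h := 2^-1 *: (x - y).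
have half : 2^-1 + 2^-1 = 1 :> R by lra.
have mDh : m + h = x.
  rewrite /m /h !scalerDr scalerN addrACA subrr addr0.
  by rewrite -scalerDl half scale1r.
have mBh : m - h = y.
  rewrite /m /h !scalerDr scalerN opprD opprK addrACA subrr add0r.
  by rewrite -scalerDl half scale1r.
have half0 : 0 <= 2^-1 :> R by rewrite invr_ge0.
have mE : `|m| = `|x + y| / 2 by rewrite normrZ ger0_norm// mulrC.
have hE : eps = 2 * `|h|.
  by rewrite normrZ ger0_norm// xy mulrA mulfV ?mul1r// pnatr_eq0.
have m1 : `|m| <= 1.
  by rewrite mE ler_pdivrMr// mul1r (le_trans (ler_normD _ _))// x1 y1 -natr1.
have : `|h| ^+ N <= K * (N%:R * (1 - `|m|)).
  apply: le_trans (HK m h _ _) _; rewrite ?mDh ?mBh ?x1 ?y1//.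
  by rewrite ler_pM2l// subr1_expr_le// normr_ge0.
rewrite hE exprMn -(ler_pM2l (exprn_gt0 N (ltr0Sn R 1))) => /le_trans; apply.
by rewrite mE le_eqVlt; apply/orP; left; apply/eqP; ring.
Qed.
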